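(* There is an absolute constant $C>0$ such that the following holds. Let $H=(V,\mathcal{E})$ be a tri-hypergraph of VC-dimension $d\geq 1$ in which every tri-edge $(B,R,W)$ has $B\neq\emptyset$. Then $\tau(H)\leq C\cdot d\cdot \tau^*(H)\cdot\ln(e\,\tau^*(H))$.
   Context: A tri-hypergraph is a pair $H=(V,\mathcal{E})$ where $V$ is a finite set and $\mathcal{E}$ is a collection of ordered partitions $(B,R,W)$ of $V$ into three (possibly empty) parts, called tri-edges. A set $X\subseteq V$ is shattered by $H$ if for every $Y\subseteq X$ there is a tri-edge $(B,R,W)$ with $X\cap B=X\cap(B\cup R)=Y$; the VC-dimension is the largest size of a shattered set. A transversal of $H$ is a set $X\subseteq V$ with $X\cap(B\cup R)\neq\emptyset$ for every tri-edge; $\tau(H)$ is the minimum size of a transversal. A fractional transversal is a function $\omega:V\to\mathbb{R}_{\geq 0}$ with $\sum_{b\in B}\omega(b)\geq 1$ for every tri-edge $(B,R,W)$; $\tau^*(H)$ is the minimum of $\sum_{v\in V}\omega(v)$ over fractional transversals (note only $B$, not $R$, counts here). *)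

(* Defs.v *)
From HB Require Import structures.
From mathcomp Require Import all_boot all_order all_algebra.
From mathcomp Require Import all_classical all_reals all_analysis.
From mathcomp Require Import Rstruct.
Set Implicit Arguments. Unset Strict Implicit. Unset Printing Implicit Defensive.
Import Order.TTheory GRing.Theory Num.Theory.
Local Open Scope ring_scope.

(* A tri-edge on a finite vertex type T is an ordered partition (B,R,W) of T
   into three possibly empty parts, encoded as the map v |-> 0 (v in B),
   1 (v in R), 2 (v in W).  A tri-hypergraph on T is a set of tri-edges. *)
Definition triedge (T : finType) := {ffun T -> 'I_3}.

Definition tB (T : finType) (e : triedge T) : {set T} := [set v | val (e v) == 0%N].
Definition tR (T : finType) (e : triedge T) : {set T} := [set v | val (e v) == 1%N].
Definition tW (T : finType) (e : triedge T) : {set T} := [set v | val (e v) == 2%N].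

Definition shattered (T : finType) (E : {set triedge T}) (X : {set T}) : Prop :=
  forall Y : {set T}, Y \subset X ->
    exists2 e, e \in E & (X :&: tB e = Y /\ X :&: (tB e :|: tR e) = Y).

Definition vc_dim_is (T : finType) (E : {set triedge T}) (d : nat) : Prop :=
  (exists2 X : {set T}, shattered E X & #|X| = d) /\
  (forall X : {set T}, shattered E X -> (#|X| <= d)%N).

Definition transversal (T : finType) (E : {set triedge T}) (X : {set T}) : bool :=
  [forall e in E, X :&: (tB e :|: tR e) != finset.set0].

(* tau(H): minimum size of a transversal (default #|T| if none exists;
   under the theorem's hypotheses the full set is a transversal). *)
Definition tau (T : finType) (E : {set triedge T}) : nat :=
  \big[minn/#|T|]_(X : {set T} | transversal E X) #|X|.

Definition frac_transversal (T : finType) (E : {set triedge T})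
    (w : {ffun T -> Rdefinitions.R}) : Prop :=
  (forall v, 0 <= w v) /\ (forall e, e \in E -> 1 <= \sum_(b in tB e) w b).

(* tau*(H): the minimum (taken as infimum; the LP minimum is attained) of
   the total weight of a fractional transversal. *)
Definition tau_star (T : finType) (E : {set triedge T}) : Rdefinitions.R :=
  inf [set (\sum_(v : T) w v) | w in frac_transversal E].

(* Main.v *)
(** Let [w] be a fractional transversal of total weight [W], and suppose that no
set of at most [m] vertices is a transversal.  Then every [m]-tuple of vertices
lies in the part [W_e] of some tri-edge [e], and since [w(B_e) >= 1] one can
append [j] vertices of [B_e] with total weight at least [1].  Since the appended
vertices all lie in [B_e], the part [R_e] is never met, so [e] cuts the sample
of [n = m + j] vertices like an ordinary set.  By Sauer-Shelah at most
[\sum_(i <= d) 'C(n, i)] of the [j]-subsets of the positions of a given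
[n]-tuple arise as the positions of the vertices in some [B_e] with the others
in [W_e].  Double counting gives
['C(n, j) <= W ^ j * \sum_(i <= d) 'C(n, i)], which fails for
[n ~ e^2 W j] and [j ~ d ln(e W)]. *)
Require Import Defs.
From HB Require Import structures.
From mathcomp Require Import all_boot all_order all_algebra.
From mathcomp Require Import all_classical all_reals all_analysis.
From mathcomp Require Import Rstruct ring lra.
Set Implicit Arguments. Unset Strict Implicit. Unset Printing Implicit Defensive.
Import Order.TTheory GRing.Theory Num.Theory.
Local Open Scope ring_scope.

(** * Shattering in set systems and the Sauer-Shelah inequality *)

Definition shatters (I : finType) (F : {set {set I}}) (X : {set I}) : bool :=
  [forall Y : {set I}, (Y \subset X) ==> [exists A in F, X :&: A == Y]].

Lemma shattersP (I : finType) (F : {set {set I}}) (X : {set I}) :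
  reflect (forall Y : {set I}, Y \subset X -> exists2 A, A \in F & X :&: A = Y)
          (shatters F X).
Proof.
apply: (iffP forallP) => [H Y sYX|H Y].
  by have /implyP/(_ sYX)/exists_inP[A AF /eqP] := H Y; exists A.
by apply/implyP => /H[A AF <-]; apply/exists_inP; exists A.
Qed.

Lemma shattersS (I : finType) (F G : {set {set I}}) (X : {set I}) :
  F \subset G -> shatters F X -> shatters G X.
Proof.
move=> sFG /shattersP H; apply/shattersP => Y /H[A AF <-].
by exists A => //; exact: (fintype.subsetP sFG).
Qed.

(* Pajor's form of Sauer-Shelah: with [x] a point separating two members, a set
   shattered by both halves [F0], [F1] yields a further one by adding [x]. *)
Lemma card_le_shattered (I : finType) (F : {set {set I}}) :
  (#|F| <= #|[set X | shatters F X]|)%N.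
Proof.
have [k] := ubnP #|F|; elim: k F => // k IH F; rewrite ltnS => Fk.
have [F1|] := leqP #|F| 1.
  have [->|/finset.set0Pn[A AF]] := eqVneq F finset.set0; first by rewrite cards0.
  apply: (leq_trans F1); rewrite card_gt0; apply/finset.set0Pn.
  exists finset.set0; rewrite inE; apply/shattersP => Y.
  by rewrite finset.subset0 => /eqP ->; exists A => //; rewrite finset.set0I.
move=> /card_gt1P[A [B [AF BF AB]]].
have [x xAB] : exists x, (x \in A) != (x \in B).
  apply/existsP; apply: contraNT AB; rewrite negb_exists => /forallP H.
  by apply/eqP/setP => x; apply/eqP; have := H x; rewrite negbK.
pose F1 := F :&: [set D : {set I} | x \in D].
pose F0 := F :\: [set D : {set I} | x \in D].
have cF : (#|F1| + #|F0|)%N = #|F| by rewrite cardsID.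
have ne : (0 < #|F1|)%N /\ (0 < #|F0|)%N.
  rewrite !card_gt0; split; apply/finset.set0Pn; move: xAB;
  case xA: (x \in A); case xB: (x \in B) => // _;
  by [exists A; rewrite !inE xA AF | exists B; rewrite !inE xB BF].
pose s0 := [set X | shatters F0 X]; pose s1 := [set X | shatters F1 X].
have x0 X : X \in s0 -> x \notin X.
  rewrite inE => /shattersP/(_ X (subxx _))[D]; rewrite !inE => /andP[xD _] <-.
  by rewrite inE negb_and xD orbT.
have x1 X : X \in s1 -> x \notin X.
  rewrite inE => /shattersP/(_ finset.set0 (finset.sub0set _))[D].
  rewrite !inE => /andP[_ xD] /setP/(_ x); rewrite !inE xD andbT => ->.
  by [].
have Fs0 : F0 \subset F by rewrite finset.subsetDl.
have Fs1 : F1 \subset F by rewrite finset.subsetIl.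
pose s2 := [set x |: X | X in s0 :&: s1].
have cs2 : #|s2| = #|s0 :&: s1|.
  apply: card_in_imset => X Y /setIP[X0 _] /setIP[Y0 _] /(congr1 (fun Z => Z :\ x)).
  by rewrite !setU1K ?x0.
have dis : [disjoint s0 :|: s1 & s2].
  apply/pred0P => Y /=; apply/negP => /andP[YU /imsetP[X _ YX]].
  have : x \in Y by rewrite YX setU11.
  by case/setUP: YU => [/x0|/x1] /negP.
have sub : (s0 :|: s1) :|: s2 \subset [set X | shatters F X].
  apply/fintype.subsetP => X; rewrite !inE -orbA => /or3P[||].
  - exact: shattersS.
  - exact: shattersS.
  (* A subset of [x |: Y] containing [x] is cut out by a member of [F1], any other subset by a
     member of [F0]. *)
  move=> /imsetP[Y /setIP[Y0 Y1] ->]; apply/shattersP => Z sZ.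
  have sZY : Z :\ x \subset Y by rewrite finset.subDset.
  have [xZ|xZ] := boolP (x \in Z).
    move: Y1; rewrite inE => /shattersP/(_ _ sZY)[D]; rewrite !inE => /andP[DF xD] DE.
    exists D => //; rewrite finset.setIUl DE -[RHS](finset.setD1K xZ); congr (_ :|: _).
    by apply/finset.setIidPl; rewrite finset.sub1set.
  move: Y0; rewrite inE => /shattersP/(_ _ sZY)[D]; rewrite !inE => /andP[xD DF] DE.
  exists D => //; rewrite finset.setIUl DE.
  apply/setP => y; rewrite !inE; have [->|_] //= := eqVneq y x.
  by rewrite (negbTE xD) (negbTE xZ).
apply: leq_trans (subset_leq_card sub).
(* The count closes because [#|s0 :|: s1| + #|s0 :&: s1| = #|s0| + #|s1|], and induction applies to
   both halves. *)
rewrite cardsU (disjoint_setI0 dis) cards0 subn0 cs2.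
rewrite cardsU subnK; last first.
  by apply: leq_trans (leq_addr _ _); rewrite subset_leq_card ?finset.subsetIl.
rewrite -cF addnC leq_add // IH //; case: ne => n1 n0; apply: leq_trans Fk.
  by rewrite -cF -{1}[#|F0|]add0n ltn_add2r.
by rewrite -cF -{1}[#|F1|]addn0 ltn_add2l.
Qed.

Lemma sauer_shelah (I : finType) (F : {set {set I}}) (d : nat) :
  (forall X, shatters F X -> (#|X| <= d)%N) ->
  (#|F| <= \sum_(i < d.+1) 'C(#|I|, i))%N.
Proof.
move=> H; apply: leq_trans (card_le_shattered F) _.
(* Shattered sets are sorted by size; [inord] is faithful here since these sizes are at most [d]. *)
rewrite -sum1_card (partition_big (fun X : {set I} => inord #|X| : 'I_d.+1) predT) //=.
apply: leq_sum => i _; rewrite -card_draws -sum1_card.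
rewrite big_mkcond [leqRHS]big_mkcond /=; apply: leq_sum => X _.
rewrite !inE; case: ifP => // /andP[/H Xd /eqP <-].
by rewrite inordK ?ltnS // eqxx.
Qed.

(** * Traces of tri-edges on samples *)

(* [z] is a sample of [n] vertices, possibly with repetitions; [J] is the set of
   positions of the vertices lying in the part [B] of a tri-edge missing [R]. *)
Definition traces (T : finType) (E : {set triedge T}) (n : nat)
    (z : {ffun 'I_n -> T}) : {set {set 'I_n}} :=
  [set J : {set 'I_n} | [exists e in E,
     [forall i, if i \in J then z i \in tB e else z i \in tW e]]].

Lemma tB_notW (T : finType) (e : triedge T) v : v \in tB e -> v \notin tW e.
Proof. by rewrite !inE => /eqP ->. Qed.

Lemma tW_notBR (T : finType) (e : triedge T) v : v \in tW e = (v \notin tB e :|: tR e).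
Proof. by rewrite !inE; case: (e v) => -[|[|[]]]. Qed.

Lemma tracesP (T : finType) (E : {set triedge T}) n (z : {ffun 'I_n -> T})
    (J : {set 'I_n}) :
  reflect (exists2 e, e \in E & forall i, if i \in J then z i \in tB e else z i \in tW e)
          (J \in traces E z).
Proof.
rewrite inE; apply: (iffP exists_inP) => -[e eE /forallP]; first by exists e.
by move=> H; exists e.
Qed.

(** Transfers the VC bound to positions. Positions holding the same vertex cannot be separated, so
    [z] is injective on [X]; and a tri-edge giving a trace misses [R] on the sample, so [B] and [B]
    with [R] cut it alike. *)
Lemma shatters_traces (T : finType) (E : {set triedge T}) n (z : {ffun 'I_n -> T}) X :
  shatters (traces E z) X -> shattered E (z @: X) /\ #|z @: X| = #|X|.
Proof.
move=> /shattersP H; split; last first.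
  apply: card_in_imset => i k iX kX zik; apply/eqP; apply: contraT => nik.
  have [J /tracesP[e eE He]] := H [set i] ltac:(by rewrite finset.sub1set).
  move=> /setP JX; have := JX i; have := JX k; rewrite !inE iX kX eqxx /=.
  rewrite eq_sym (negbTE nik) => kJ iJ; have := He i; have := He k.
  by rewrite kJ iJ zik => kW /tB_notW/negP.
move=> Y sY.
have [J /tracesP[e eE He] JX] := H (X :&: z @^-1: Y) (finset.subsetIl _ _).
have memJ i : i \in X -> (i \in J) = (z i \in Y).
  by move=> iX; have := congr1 (fun S : {set _} => i \in S) JX; rewrite !inE iX.
exists e => //.
have BR i : (z i \in tB e :|: tR e) = (i \in J).
  apply/idP/idP => [|iJ].
    by apply: contraLR => iJ; have := He i; rewrite (negbTE iJ) tW_notBR.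
  by have := He i; rewrite iJ finset.in_setU => ->.
have Bj i : (z i \in tB e) = (i \in J).
  apply/idP/idP => [|iJ]; last by have := He i; rewrite iJ.
  by rewrite -BR finset.in_setU => ->.
split; apply/setP => v; rewrite finset.in_setI; apply/idP/idP.
- by case/andP => /imsetP[i iX ->]; rewrite Bj memJ.
- move=> vY; have vX := fintype.subsetP sY _ vY; rewrite vX.
  by case/imsetP: vX vY => i iX ->; rewrite Bj memJ.
- by case/andP => /imsetP[i iX ->]; rewrite BR memJ.
- move=> vY; have vX := fintype.subsetP sY _ vY; rewrite vX.
  by case/imsetP: vX vY => i iX ->; rewrite BR memJ.
Qed.

Lemma card_traces (T : finType) (E : {set triedge T}) d n (z : {ffun 'I_n -> T}) :
  vc_dim_is E d -> (#|traces E z| <= \sum_(i < d.+1) 'C(n, i))%N.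
Proof.
move=> [_ H]; have := @sauer_shelah _ (traces E z) d; rewrite card_ord; apply => X.
by move=> /shatters_traces[/H + <-].
Qed.

(** * Double counting of weighted samples *)

(** The left side is the total weight of all fillings of the positions outside [J]. The vertices of
    such a filling miss [B] and [R] of some tri-edge, and filling [J] from its [B] multiplies the
    weight by at least 1 per position. *)
Lemma bad_sample_weight (R : realType) (T : finType) (E : {set triedge T})
    (w : T -> R) n (J : {set 'I_n}) :
    (forall v, 0 <= w v) ->
    (forall e, e \in E -> 1 <= \sum_(b in tB e) w b) ->
    (forall X, Defs.transversal E X -> (n - #|J| < #|X|)%N) ->
  (\sum_v w v) ^+ (n - #|J|) <=
    \sum_(z : {ffun 'I_n -> T} | J \in traces E z) \prod_i w (z i).
Proof.
move=> w0 wB ntr.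
have missed (X : {set T}) : (#|X| <= n - #|J|)%N ->
    {e | e \in E & X :&: (tB e :|: tR e) = finset.set0}.
  rewrite leqNgt => /negP Xn; apply: cid2; apply: contrapT => H; apply/Xn/ntr.
  by apply/forall_inP => e eE; apply/eqP => Xe; apply: H; exists e.
pose Jc := ~: J.
have cJc : #|Jc| = (n - #|J|)%N by rewrite cardsCs finset.setCK card_ord.
(* The empty set is not a transversal, and the tri-edge it misses has [B] of weight at least 1,
   hence nonempty. *)
have [v0] : exists v0 : T, true.
  have [e /wB eE _] := missed finset.set0 ltac:(by rewrite cards0).
  case: (pickP [in tB e]) => [v _|H]; first by exists v.
  by move: eE; rewrite big_pred0 // ler10.
move=> _.
pose Q0 := fun i : 'I_n => if i \in J then pred1 v0 else predT.
(* The tuples [z] are grouped according to their restriction to [~: J], encoded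
   by the tuple with value [v0] on [J]. *)
pose pad (z : {ffun 'I_n -> T}) := [ffun i => if i \in J then v0 else z i].
have img (y : {ffun 'I_n -> T}) : (#|y @: Jc| <= n - #|J|)%N.
  by rewrite -cJc leq_imset_card.
pose ed y := s2val (missed _ (img y)).
(* The completions of [y]: unchanged outside [J], and on [J] with values in [B] of the tri-edge
   missed by [y]. *)
pose Q1 (y : {ffun 'I_n -> T}) := fun i : 'I_n =>
  if i \in J then [pred x in tB (ed y)] else pred1 (y i).
have edE y : ed y \in E := s2valP (missed _ (img y)).
have edW (y : {ffun 'I_n -> T}) i : i \notin J -> y i \in tW (ed y).
  move=> iJ; rewrite tW_notBR; apply/negP => yi.
  have := s2valP' (missed _ (img y)) => /setP/(_ (y i)).
  rewrite finset.in_setI finset.in_set0 yi andbT imset_f // finset.in_setC.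
  by rewrite iJ.
have sumJ (F : 'I_n -> R) c : (forall i, F i = if i \in J then 1 else c) ->
    \prod_i F i = c ^+ (n - #|J|).
  move=> HF; rewrite (bigID [in J]) /= big1 => [|i iJ]; last by rewrite HF iJ.
  rewrite mul1r (eq_bigr (fun=> c)) => [|i /negbTE iJ]; last by rewrite HF iJ.
  rewrite prodr_const -cJc; congr (_ ^+ _); apply: eq_card => i.
  by rewrite /Jc !inE.
pose g (i : 'I_n) x : R := if i \in J then 1 else w x.
have -> : (\sum_v w v) ^+ (n - #|J|) = \sum_(y in family Q0) \prod_i g i (y i).
  rewrite -bigA_distr_big_dep; symmetry; apply: sumJ => i; rewrite /Q0 /g.
  by case: ifP => // iJ; rewrite big_pred1_eq.
rewrite [leRHS](partition_big pad [in family Q0]) /=; last first.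
  move=> z _; apply/familyP => i; rewrite ffunE /Q0.
  by case: ifP => _; rewrite !inE.
apply: ler_sum => y yQ.
apply: (@le_trans _ _ (\sum_(z in family (Q1 y)) \prod_i w (z i))).
  rewrite -(bigA_distr_big_dep _ (fun=> w)); apply: ler_prod => i _; rewrite /g /Q1.
  case: ifP => iJ; first by rewrite ler01 wB.
  by rewrite w0 big_pred1_eq lexx.
rewrite [leLHS]big_mkcond [leRHS]big_mkcond /=; apply: ler_sum => z _.
have P0 : 0 <= \prod_i w (z i) by apply: prodr_ge0.
case: ifP => [/familyP zQ|_]; last by case: ifP.
suff -> : (J \in traces E z) && (pad z == y) by [].
have zy i : i \notin J -> z i = y i.
  by move=> /negbTE iJ; have := zQ i; rewrite /Q1 iJ inE => /eqP.
apply/andP; split.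
  apply/tracesP; exists (ed y) => // i; case: ifPn => iJ; last by rewrite zy // edW.
  by have := zQ i; rewrite /Q1 iJ inE.
apply/eqP/ffunP => i; rewrite ffunE; case: ifPn => iJ; last exact: zy.
by have /familyP/(_ i) := yQ; rewrite /Q0 iJ inE => /eqP.
Qed.

(** Pairs [(J, z)] with [#|J| = j] and [J] a trace on [z] are weighed by [z]: from below for each
    [J] by [bad_sample_weight], from above for each [z] by [card_traces]. The common factor
    [W ^+ (n - j)] cancels. *)
Lemma bin_le_sauer (R : realType) (T : finType) (E : {set triedge T})
    (w : T -> R) d n j :
    vc_dim_is E d -> (j <= n)%N -> 0 < \sum_v w v ->
    (forall v, 0 <= w v) ->
    (forall e, e \in E -> 1 <= \sum_(b in tB e) w b) ->
    (forall X, Defs.transversal E X -> (n - j < #|X|)%N) ->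
  'C(n, j)%:R <= (\sum_(i < d.+1) 'C(n, i))%:R * (\sum_v w v) ^+ j.
Proof.
move=> dE jn W0 w0 wB ntr; set W := \sum_v w v.
have Wn : W ^+ n = W ^+ j * W ^+ (n - j) by rewrite -exprD subnKC.
rewrite -(ler_pM2r (exprn_gt0 (n - j) W0)) -mulrA -Wn.
rewrite -[n in 'C(n, j)]card_ord -card_draws -sum1_card natr_sum mulr_suml.
apply: (@le_trans _ _ (\sum_(J : {set 'I_n} | #|J| == j)
    \sum_(z : {ffun 'I_n -> T} | J \in traces E z) \prod_i w (z i))).
  rewrite [leLHS](eq_bigl (fun J : {set 'I_n} => #|J| == j)); last first.
    by move=> J; rewrite inE.
  apply: ler_sum => J /eqP Jj; rewrite mul1r -Jj; apply: bad_sample_weight => //.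
  by rewrite Jj.
rewrite (exchange_big_dep predT) //=.
have -> : W ^+ n = \sum_(z : {ffun 'I_n -> T}) \prod_i w (z i).
  by rewrite -(bigA_distr_bigA (fun=> w)) prodr_const card_ord.
rewrite mulr_sumr; apply: ler_sum => z _.
rewrite sumr_const -[leLHS]mulr_natl ler_wpM2r ?prodr_ge0 // ler_nat.
apply: leq_trans (card_traces z dE); apply: subset_leq_card.
by apply/fintype.subsetP => J /andP[].
Qed.

(** * Binomial estimates *)

(** The binomial coefficient is the product over [i < j] of [(r * j - i) / (j - i)], and each factor
    is at least [r]. *)
Lemma expn_le_bin (r j : nat) : (0 < r)%N -> (r ^ j <= 'C(r * j, j))%N.
Proof.
move=> r0; rewrite -(leq_pmul2r (fact_gt0 j)) bin_ffact -ffactnn !ffact_prod.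
rewrite -[X in (r ^ X)%N](card_ord j) -prod_nat_const -big_split /=.
by apply: leq_prod => i _; rewrite mulnBr leq_sub2l // leq_pmull.
Qed.

(* Comparison with the binomial expansion of [(1 + 1/r) ^ (r * j) <= e ^ j]. *)
Lemma sum_bin_le (R : realType) (r j d : nat) : (0 < r)%N -> (d <= j)%N ->
  (\sum_(i < d.+1) 'C(r * j, i))%:R <= r%:R ^+ d * expR 1 ^+ j :> R.
Proof.
move=> r0 dj; set n := (r * j)%N.
have dn : (d <= n)%N by rewrite (leq_trans dj) // leq_pmull.
have rR : 0 < r%:R :> R by rewrite ltr0n.
have -> : expR 1 ^+ j = expR r%:R^-1 ^+ n :> R.
  by rewrite -!expRM_natl /n natrM mulr1 mulrAC mulfV ?mul1r // gt_eqF.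
apply: (@le_trans _ _ (r%:R ^+ d * (1 + r%:R^-1) ^+ n)); last first.
  by rewrite ler_wpM2l ?exprn_ge0 ?ler0n // lerXn2r ?nnegrE ?expR_ge0 ?expR_ge1Dx.
(* For [i <= d], the factor [r ^ d] absorbs the [r ^ (- i)] of the expansion; the other terms are
   nonnegative. *)
rewrite exprDn mulr_sumr natr_sum (big_ord_widen n.+1 (fun i => 'C(n, i)%:R)) ?ltnS //.
rewrite big_mkcond /=; apply: ler_sum => i _; rewrite expr1n mul1r.
case: ifP => [id|_]; last first.
  by rewrite mulr_ge0 ?exprn_ge0 ?mulrn_wge0 ?exprn_ge0 ?invr_ge0 ?ler0n.
rewrite mulrnAr -[leRHS]mulr_natl ler_peMr ?ler0n // exprVn.
rewrite -exprB ?unitfE ?gt_eqF //.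
by rewrite exprn_ege1 // ler1n.
Qed.

(** * Choice of the sample size *)

Lemma small_transversal (R : realType) (T : finType) (E : {set triedge T})
    (w : T -> R) (d : nat) :
    vc_dim_is E d -> (1 <= d)%N ->
    (forall v, 0 <= w v) ->
    (forall e, e \in E -> 1 <= \sum_(b in tB e) w b) ->
    1 <= \sum_v w v ->
  exists2 X, Defs.transversal E X &
    #|X|%:R <= 6 * expR 1 ^+ 2 * d%:R * (\sum_v w v) * ln (expR 1 * \sum_v w v).
Proof.
move=> dE d1 w0 wB; set W := \sum_v w v => W1; set e := expR 1 : R.
have W0 : 0 < W by rewrite (lt_le_trans ltr01).
have e0 : 0 < e by rewrite expR_gt0.
have e1 : 1 <= e by have := expR_ge1Dx (1 : R); rewrite -/e; lra.
have eW0 : 0 < e * W by rewrite mulr_gt0.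
set L := ln (e * W).
have LE : L = 1 + ln W by rewrite /L lnM ?posrE // expRK.
have L1 : 1 <= L by rewrite LE lerDl ln_ge0.
(* Rounding is arranged so that [ln r > L + 1] and [j > d * (L + 1)], while [r <= 2 * e ^ 2 * W] and
   [j <= 3 * d * L]; the last two give the constant 6 in the bound on [n]. *)
pose r := (Num.truncn (e ^+ 2 * W)).+1.
pose j := (d * (Num.truncn L).+2)%N.
pose n := (r * j)%N.
have rgt : e ^+ 2 * W < r%:R by exact: truncnS_gt.
have e2W : 1 <= e ^+ 2 * W by rewrite mulr_ege1 // exprn_ege1.
have rle : r%:R <= 2 * (e ^+ 2 * W).
  rewrite /r -natr1 mulr_natl mulr2n lerD //.
  by rewrite truncn_le (le_trans ler01).
have jle : j%:R <= d%:R * (3 * L).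
  rewrite /j natrM ler_wpM2l ?ler0n // -addn2 natrD.
  have : (Num.truncn L)%:R <= L by rewrite truncn_le (le_trans ler01).
  lra.
have jgt : d%:R * (L + 1) < j%:R.
  rewrite /j natrM ltr_pM2l ?ltr0n // -natr1 ltrD2r.
  exact: truncnS_gt.
have jn : (j <= n)%N by rewrite leq_pmull.
have dj : (d <= j)%N by rewrite leq_pmulr.
have [[X trX Xn]|H] := pselect (exists2 X, Defs.transversal E X & (#|X| <= n - j)%N).
  exists X => //; apply: (@le_trans _ _ n%:R).
    by rewrite ler_nat (leq_trans Xn) // leq_subr.
  rewrite /n natrM; apply: (@le_trans _ _ ((2 * (e ^+ 2 * W)) * (d%:R * (3 * L)))).
    by rewrite ler_pM ?ler0n.
  by rewrite le_eqVlt; apply/orP; left; apply/eqP; ring.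
exfalso.
have ntr X : Defs.transversal E X -> (n - j < #|X|)%N.
  by move=> trX; rewrite ltnNge; apply/negP => Xn; apply: H; exists X.
have r0 : 0 < r%:R :> R by rewrite ltr0n.
have key : r%:R ^+ j <= r%:R ^+ d * (e * W) ^+ j.
  apply: (@le_trans _ _ 'C(n, j)%:R); first by rewrite -natrX ler_nat expn_le_bin.
  apply: (le_trans (bin_le_sauer dE jn W0 w0 wB ntr)).
  rewrite exprMn mulrA ler_wpM2r ?exprn_ge0 ?(ltW W0) //.
    exact: sum_bin_le.
have lr : L + 1 < ln r%:R.
  have -> : L + 1 = ln (e ^+ 2 * W).
    by rewrite lnM ?posrE ?exprn_gt0 // lnXn // expRK LE; ring.
  by rewrite ltr_ln ?posrE // mulr_gt0 ?exprn_gt0.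
have lnX k x : 0 < x -> ln (x ^+ k) = k%:R * ln x :> R.
  by move=> x0; rewrite lnXn // mulr_natl.
(* In logarithms [key] reads [(j - d) * ln r <= j * L], but the left side is at least [(j - d) * (L
   + 1) = j * L + (j - d * (L + 1)) > j * L]. *)
move: key; rewrite -ler_ln ?posrE ?mulr_gt0 ?exprn_gt0 // lnM ?posrE ?exprn_gt0 //.
rewrite !lnX // -/L.
have : d%:R <= j%:R :> R by rewrite ler_nat.
have : 1 <= d%:R :> R by rewrite ler1n.
nra.
Qed.

(** * Passage to the infimum [tau_star] *)

Lemma tau_le (T : finType) (E : {set triedge T}) X :
  Defs.transversal E X -> (tau E <= #|X|)%N.
Proof.
move=> trX; rewrite /tau -big_filter.
have : X \in [seq Y <- index_enum _ | Defs.transversal E Y].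
  by rewrite mem_filter trX mem_index_enum.
elim: [seq _ <- _ | _] => // Y s IH; rewrite inE big_cons geq_min.
by case/orP => [/eqP <-|/IH ->]; rewrite ?leqnn ?orbT.
Qed.

Theorem theorem1p7 :
  exists C : Rdefinitions.R, 0 < C /\
    forall (T : finType) (E : {set triedge T}) (d : nat),
      vc_dim_is E d -> (1 <= d)%N ->
      (forall e, e \in E -> tB e != finset.set0) ->
      (tau E)%:R <= C * d%:R * tau_star E * ln (expR 1 * tau_star E).
Proof.
(* The 6 of [small_transversal] is doubled twice: once for [W <= 2 * s], once for the logarithm. *)
exists (24 * expR 1 ^+ 2); split; first by rewrite mulr_gt0 ?exprn_gt0 ?expR_gt0.
move=> T E d dE d1 nB.
set A := [set (\sum_(v : T) w v) | w in frac_transversal E]%classic.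
(* Some tri-edge exists, since a shattered set has its empty subset cut out; the total weight is at
   least that of its [B]. *)
have lbA : lbound A 1.
  move=> _ [w [w0 wB] <-].
  have [[X sX _] _] := dE; have [e eE _] := sX _ (finset.sub0set X).
  apply: le_trans (wB e eE) _; rewrite big_mkcond; apply: ler_sum => v _.
  by case: ifP.
have A0 : (A !=set0)%classic.
  exists (\sum_(v : T) [ffun=> 1 : Rdefinitions.R] v); exists [ffun=> 1] => //.
  split=> [v|e eE]; first by rewrite ffunE ler01.
  have /finset.set0Pn[v vB] := nB e eE; rewrite (bigD1 v) //= ffunE lerDl.
  by apply: sumr_ge0 => i _; rewrite ffunE ler01.
have s1 : 1 <= tau_star E by exact: lb_le_inf.
(* Attainment of the infimum is avoided: a fractional transversal of weight below [s + 1 <= 2 * s]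
   suffices. *)
have [_ [w [w0 wB] <-]] := inf_adherent (ltr01 : 0 < 1 :> Rdefinitions.R)
  (conj A0 (ex_intro _ 1 lbA)).
rewrite -/(tau_star E); set s := tau_star E in s1 * => Ws.
have W1 : 1 <= \sum_v w v by apply: lbA; exists w.
have [X trX] := small_transversal dE d1 w0 wB W1.
set W := \sum_v w v in W1 Ws * => Xle.
have {}Ws : W <= 2 * s by lra.
have s0 : 0 < s by rewrite (lt_le_trans ltr01).
have e0 : 0 < expR 1 :> Rdefinitions.R by rewrite expR_gt0.
have lns : 1 <= ln (expR 1 * s) by rewrite lnM ?posrE // expRK lerDl ln_ge0.
(* Since [W <= 2 * s <= expR 1 * s], the logarithm grows by at most 1, which is at most
   [ln (expR 1 * s)]. *)
have lnW : ln (expR 1 * W) <= 2 * ln (expR 1 * s).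
  apply: (@le_trans _ _ (1 + ln (expR 1 * s))); last lra.
  rewrite -[X in X + _](expRK (1 : Rdefinitions.R)) -lnM ?posrE ?mulr_gt0 //.
  rewrite ler_ln ?posrE ?mulr_gt0 ?(lt_le_trans ltr01 W1) // ler_pM2l //.
  apply: (le_trans Ws); rewrite ler_pM2r //.
  by have := expR_ge1Dx (1 : Rdefinitions.R).
apply: (@le_trans _ _ #|X|%:R); first by rewrite ler_nat tau_le.
apply: (le_trans Xle).
have -> : 24 * expR 1 ^+ 2 * d%:R * s * ln (expR 1 * s) =
  6 * expR 1 ^+ 2 * d%:R * (2 * s) * (2 * ln (expR 1 * s)) by ring.
apply: ler_pM => //; last 1 first.
- by rewrite ler_wpM2l ?mulr_ge0 ?exprn_ge0 ?ler0n ?(ltW e0).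
- by rewrite !mulr_ge0 ?exprn_ge0 ?ler0n ?(ltW e0) ?(le_trans ler01 W1).
- rewrite ln_ge0 //; apply: mulr_ege1 => //.
  by have := expR_ge1Dx (1 : Rdefinitions.R); lra.
Qed.
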